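(* Let $X\subseteq\mathbb{R}^n$ and $Y\subseteq\mathbb{R}^m$ be nonempty, closed and convex, let $f:\mathbb{R}^n\times\mathbb{R}^m\to\mathbb{R}$ be continuously differentiable with $\max_{y\in Y}f(x,y)$ finite for every $x\in X$, and let $(\hat x,\hat y)\in X\times Y$ be a local minimax point of $\min_{x\in X}\max_{y\in Y}f(x,y)$. (i) Then $$0\in\nabla_xf(\hat x,\hat y)+\mathcal{N}_X(\hat x),\qquad 0\in-\nabla_yf(\hat x,\hat y)+\mathcal{N}_Y(\hat y).$$ (ii) Assume, further, that $f$ is twice continuously differentiable. Then $$\langle v,\nabla_{xx}^2f(\hat x,\hat y)v\rangle\ge0\ \text{ for all } v\in\mathrm{cl}\{\bar v:\exists\,\delta>0,\ \bar v\in\Gamma_1^\circ(\hat x,y')\ \ \forall y'\in\mathbb{B}(\hat y,\delta)\},$$ $$\langle w,\nabla_{yy}^2f(\hat x,\hat y)w\rangle\le0\ \text{ for all } w\in\mathrm{cl}\,\Gamma_2^\circ(\hat x,\hat y).$$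
   Context: $\|\cdot\|$ is the Euclidean norm, $\mathbb{B}(x,r)$ is the closed ball with center $x$ and radius $r$, and $\mathrm{cl}$ denotes closure. Local minimax point: $(\hat x,\hat y)\in X\times Y$ is a local minimax point of $\min_{x\in X}\max_{y\in Y}f(x,y)$ if there exist $\delta_0>0$ and a function $\tau:\mathbb{R}_+\to\mathbb{R}_+$ (which may be, and is, taken monotone and continuous) with $\tau(\delta)\to0$ as $\delta\to0$, such that for every $\delta\in(0,\delta_0]$ and every $(x,y)\in X\times Y$ with $\|x-\hat x\|\le\delta$, $\|y-\hat y\|\le\delta$, $$f(\hat x,y)\le f(\hat x,\hat y)\le \max_{y'\in\{y\in Y:\|y-\hat y\|\le\tau(\delta)\}}f(x,y').$$ For a closed convex set $\Omega$ and $\bar x\in\Omega$: $\mathcal{N}_\Omega(\bar x)=\{z:\langle z,\omega-\bar x\rangle\le0\ \forall\omega\in\Omega\}$ and $\mathcal{T}_\Omega^\circ(\bar x)=\{w:\exists\,\lambda>0\text{ with }\bar x+\lambda w\in\Omega\}$. $\Gamma_1^\circ(x,y)=\{v\in\mathcal{T}_X^\circ(x):v\perp\nabla_xf(x,y)\}$ for $x\in X$, $y\in\mathbb{R}^m$; $\Gamma_2^\circ(x,y)=\{w\in\mathcal{T}_Y^\circ(y):w\perp\nabla_yf(x,y)\}$ for $(x,y)\in X\times Y$. *)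

(* Defs.v *)
From mathcomp Require Import all_boot all_order all_algebra.
From mathcomp Require Import all_classical all_reals all_analysis.
Import Order.TTheory GRing.Theory Num.Theory.
Import numFieldNormedType.Exports.

Set Implicit Arguments.
Unset Strict Implicit.
Unset Printing Implicit Defensive.

Local Open Scope classical_set_scope.
Local Open Scope ring_scope.

Definition dot (R : realType) (k : nat) (u v : 'rV[R]_k) : R :=
  \sum_(i < k) u 0 i * v 0 i.

(* The canonical norm `|u| on 'rV[R]_k is the sup norm; the two norms induce
   the same topology, so [closed], [closure] and [differentiable] below are
   the Euclidean ones. *)
Definition enorm (R : realType) (k : nat) (u : 'rV[R]_k) : R :=
  Num.sqrt (dot u u).

Definition eball (R : realType) (k : nat) (c : 'rV[R]_k) (r : R)
  : set 'rV[R]_k := [set u | enorm (u - c) <= r].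

Definition grad (R : realType) (k : nat) (g : 'rV[R]_k -> R) (z : 'rV[R]_k)
  : 'rV[R]_k := \row_i 'D_(delta_mx 0 i) g z.

Definition hess (R : realType) (k : nat) (g : 'rV[R]_k -> R) (z : 'rV[R]_k)
  : 'M[R]_k :=
  \matrix_(i, j) 'D_(delta_mx 0 i) (fun u => 'D_(delta_mx 0 j) g u) z.

Definition gradx (R : realType) (n m : nat) (f : 'rV[R]_n * 'rV[R]_m -> R)
  (x : 'rV[R]_n) (y : 'rV[R]_m) : 'rV[R]_n := grad (fun u => f (u, y)) x.

Definition grady (R : realType) (n m : nat) (f : 'rV[R]_n * 'rV[R]_m -> R)
  (x : 'rV[R]_n) (y : 'rV[R]_m) : 'rV[R]_m := grad (fun u => f (x, u)) y.

Definition hessxx (R : realType) (n m : nat) (f : 'rV[R]_n * 'rV[R]_m -> R)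
  (x : 'rV[R]_n) (y : 'rV[R]_m) : 'M[R]_n := hess (fun u => f (u, y)) x.

Definition hessyy (R : realType) (n m : nat) (f : 'rV[R]_n * 'rV[R]_m -> R)
  (x : 'rV[R]_n) (y : 'rV[R]_m) : 'M[R]_m := hess (fun u => f (x, u)) y.

(* Pointwise continuity of z |-> 'd f z on every v is continuity of z |-> 'd f z
   for the operator norm when V is finite-dimensional, the only case used. *)
Definition C1 (R : realType) (V : normedModType R) (f : V -> R) : Prop :=
  (forall z, differentiable f z) /\
  (forall v, continuous (fun z => 'd f z v)).

Definition C2 (R : realType) (V : normedModType R) (f : V -> R) : Prop :=
  C1 f /\ (forall v, C1 (fun z => 'd f z v)).

(* The maximum is read as the supremum in the extended reals; for continuous f
   it is attained whenever S is compact and nonempty. *)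
Definition max_over (R : realType) (n m : nat) (f : 'rV[R]_n * 'rV[R]_m -> R)
  (x : 'rV[R]_n) (S : set 'rV[R]_m) : \bar R :=
  ereal_sup [set (f (x, y))%:E | y in S].

(* [tau] stands for a function on the nonnegative reals: its values at negative
   arguments are irrelevant.  Asking that it be monotone and continuous would
   give the same notion for continuous f, since enlarging [tau] only enlarges
   the last maximum. *)
Definition local_minimax (R : realType) (n m : nat) (X : set 'rV[R]_n)
  (Y : set 'rV[R]_m) (f : 'rV[R]_n * 'rV[R]_m -> R)
  (xh : 'rV[R]_n) (yh : 'rV[R]_m) : Prop :=
  [/\ X xh, Y yh &
   exists (delta0 : R) (tau : R -> R),
   [/\ 0 < delta0,
       forall delta : R, 0 <= delta -> 0 <= tau delta,
       tau delta @[delta --> 0^'+] --> 0 &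
       forall delta : R, 0 < delta <= delta0 ->
       forall x y, X x -> Y y ->
         enorm (x - xh) <= delta -> enorm (y - yh) <= delta ->
         f (xh, y) <= f (xh, yh) /\
         ((f (xh, yh))%:E <=
          max_over f x [set y' | Y y' /\ (enorm (y' - yh) <= tau delta)%R])%E]].

Definition normal_cone (R : realType) (k : nat) (Omega : set 'rV[R]_k)
  (xb : 'rV[R]_k) : set 'rV[R]_k :=
  [set z | forall w, Omega w -> dot z (w - xb) <= 0].

Definition feasible_dirs (R : realType) (k : nat) (Omega : set 'rV[R]_k)
  (xb : 'rV[R]_k) : set 'rV[R]_k :=
  [set w | exists2 l : R, 0 < l & Omega (xb + l *: w)].

Definition Gamma1 (R : realType) (n m : nat) (X : set 'rV[R]_n)
  (f : 'rV[R]_n * 'rV[R]_m -> R) (x : 'rV[R]_n) (y : 'rV[R]_m)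
  : set 'rV[R]_n :=
  [set v | feasible_dirs X x v /\ dot v (gradx f x y) = 0].

Definition Gamma2 (R : realType) (n m : nat) (Y : set 'rV[R]_m)
  (f : 'rV[R]_n * 'rV[R]_m -> R) (x : 'rV[R]_n) (y : 'rV[R]_m)
  : set 'rV[R]_m :=
  [set w | feasible_dirs Y y w /\ dot w (grady f x y) = 0].

(* Main.v *)
From HB Require Import structures.
Require Import Defs.
From mathcomp Require Import all_boot all_order all_algebra.
From mathcomp Require Import all_classical all_reals all_analysis.
From mathcomp Require Import lra ring.
Import Order.TTheory GRing.Theory Num.Theory.
Import numFieldNormedType.Exports.

Local Open Scope classical_set_scope.
Local Open Scope ring_scope.

Set Implicit Arguments.
Unset Strict Implicit.
Unset Printing Implicit Defensive.

(** Along a feasible direction, each player compares two values of [f], and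
    both comparisons say the same thing: [f] (or [- f], for the second player)
    does not decrease, up to an error of order [t ^ 2], when one moves from a
    point close to [(xh, yh)] by a short step [t] in a fixed direction.

    For the second player this is immediate: [yh] maximizes [f (xh, _)] on a
    neighbourhood of [yh] in [Y].  For the first player let [x] be a point of
    [X] obtained from [xh] by a step [t] in the direction [v].  The minimax
    inequality bounds [f (xh, yh)] by the supremum of [f (x, _)] over a small
    set, so some [y] in that set satisfies [f (xh, yh) - c * t ^ 2 <= f (x, y)];
    since [yh] is a local maximizer, [f (xh, y) <= f (xh, yh)], and therefore
    [f (xh, y) - c * t ^ 2 <= f (x, y)].  The base point [(xh, y)] depends on
    the step, but it tends to [(xh, yh)] because the radius [tau] does.

    The predicate [creeping] records this situation, in an arbitrary normed
    space and with the slack constant as small as one likes.  It yields both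
    conclusions.  At first order, the mean value theorem turns the increments
    into directional derivatives at points tending to [(xh, yh)], and
    continuity of the differential gives [0 <= 'd f (xh, yh) d]
    ([creeping_diff_ge0]).  At second order, if moreover the derivative in the
    direction [d] vanishes at every base point, a negative second derivative
    would force a decrease of at least a fixed multiple of [t ^ 2], which
    beats the slack ([creeping_diff2_ge0]).  Here lies the reason for asking,
    for the first player, that the direction be orthogonal to the gradient on
    a whole ball around [yh]: the base points move.

    It remains to read gradients and Hessians of partial functions as
    differentials of [f] ([dot_grad_affine], [dot_hess_affine]) and to pass
    to the closure, quadratic forms being continuous
    ([closed_quadratic_ge0]). *)

(** * Derivatives along lines and affine maps *)

(** The chain rule for an affine map: the difference quotients of [g \o a]
    along [v] and of [g] along [w] are the same function. *)
Lemma is_derive_affine (R : realType) (U V W : normedModType R)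
    (g : V -> W) (a : U -> V) (u v : U) (w : V) :
  (forall h : R, a (h *: v + u) = h *: w + a u) ->
  differentiable g (a u) -> is_derive u v (g \o a) ('d g (a u) w).
Proof.
move=> aE dg.
have qE : (fun h : R => h^-1 *: ((g \o a \o shift u) (h *: v) - (g \o a) u))
        = (fun h : R => h^-1 *: ((g \o shift (a u)) (h *: w) - g (a u))).
  by apply/funext => h /=; rewrite aE.
apply: DeriveDef; first by rewrite /derivable qE; exact: diff_derivable.
by rewrite -deriveE// /derive qE.
Qed.

Lemma is_derive_line (R : realType) (V : normedModType R) (g : V -> R)
    (q d : V) (s : R) :
  (forall z, differentiable g z) ->
  is_derive s 1 (fun s => g (q + s *: d)) ('d g (q + s *: d) d).
Proof.
move=> dg; apply: (@is_derive_affine R R V R g (fun s => q + s *: d)) => //.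
by move=> h; rewrite -[h *: 1]/(h * 1) mulr1 scalerDl addrCA.
Qed.

Lemma MVT_line (R : realType) (V : normedModType R) (g : V -> R) (q d : V)
    (t : R) :
  (forall z, differentiable g z) -> 0 < t ->
  exists2 s, 0 < s < t & g (q + t *: d) - g q = t * 'd g (q + s *: d) d.
Proof.
move=> dg t0.
have [||s] := @MVT R (fun s => g (q + s *: d)) (fun s => 'd g (q + s *: d) d) _ _ t0.
- by move=> s _; exact: is_derive_line.
- by apply: derivable_within_continuous => s _; have [] := is_derive_line q d s dg.
by rewrite in_itv/= scale0r addr0 subr0 mulrC => st gE; exists s.
Qed.

(** * Steps that lose only a small multiple of the squared length *)

(** The base point [q] may vary with the step [t]: in the minimax problem it
    carries the answer of the second player, which depends on the step.  The
    slack leaves room for choosing this answer below a supremum that need not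
    be attained, and is of order [t ^ 2] with an arbitrary constant so that a
    loss caused by a negative second derivative exceeds it. *)
Definition creeping {R : realType} {V : normedModType R} (g : V -> R) (p d : V)
    (P : set V) : Prop :=
  forall e c : R, 0 < e -> 0 < c -> exists t q,
    [/\ 0 < t < e, `|q - p| < e, P q & g q - c * t ^+ 2 <= g (q + t *: d)].

(** The form in which creeping is used: a property holding near [p] may be
    assumed along the whole step, since both its ends tend to [p]. *)
Lemma creeping_near (R : realType) (V : normedModType R) (g : V -> R)
    (p d : V) (P : set V) (A : set V) (c : R) :
  creeping g p d P -> nbhs p A -> 0 < c -> exists t q,
    [/\ 0 < t < 1, P q, g q - c * t ^+ 2 <= g (q + t *: d) &
        forall s, 0 <= s <= t -> A (q + s *: d)].
Proof.
move=> gd /nbhs_ballP[e /= e0 eA] c0.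
have d0 : 0 < `|d| + 1 by rewrite ltr_wpDl.
have [//|t [q [/andP[t0]]]] := gd (Num.min 1 (Num.min (e / 2) (e / 2 / (`|d| + 1)))) c _ c0.
  by rewrite !lt_min ltr01 !divr_gt0.
rewrite !lt_min => /and3P[t1 te ted] /and3P[_ qp _] Pq gq.
exists t, q; split=> // [|s /andP[s0 st]]; first by rewrite t0.
apply: eA; rewrite -ball_normE /= distrC -addrA [_ *: _ - _]addrC addrA.
apply: le_lt_trans (ler_normD _ _) _; rewrite (splitr e) ltrD//.
rewrite normrZ ger0_norm//.
rewrite ltr_pdivlMr// in ted.
apply: le_lt_trans ted; apply: ler_pM => //.
by rewrite lerDl.
Qed.

(** If the derivative at [p] were negative, it would stay below some [- c] along
    a step of length [t < 1], and the step would lose more than [c * t], hence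
    more than the slack [c * t ^ 2]. *)
Lemma creeping_diff_ge0 (R : realType) (V : normedModType R) (g : V -> R)
    (p d : V) (P : set V) :
  C1 g -> creeping g p d P -> 0 <= 'd g p d.
Proof.
move=> [dg cg] gd; rewrite leNgt; apply/negP => L0.
set c := - 'd g p d / 2.
have c0 : 0 < c by rewrite divr_gt0// oppr_gt0.
have nb : nbhs p [set z | 'd g z d < - c].
  by apply: (cvgr_lt ('d g p d)); [exact: cg|rewrite /c; lra].
have [t [q [/andP[t0 t1] _ gq near]]] := creeping_near gd nb c0.
have [s /andP[s0 st] gE] := MVT_line q d dg t0.
have /= := near s; rewrite (ltW s0) (ltW st) => /(_ isT) dlt.
have tdlt : t * 'd g (q + s *: d) d < t * - c by rewrite ltr_pM2l.
have tc : 0 < t * c * (1 - t) by apply: mulr_gt0; [exact: mulr_gt0|lra].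
nra.
Qed.

(** If the second derivative at [p] were negative, it would stay below some
    [- c] along a step.  As the first derivative vanishes at its start, the
    step would then lose at least [c / 2 * t ^ 2], while the slack is taken with
    the constant [c / 4]. *)
Lemma creeping_diff2_ge0 (R : realType) (V : normedModType R) (g : V -> R)
    (p d : V) (P : set V) :
  C2 g -> (forall q, P q -> 'd g q d = 0) -> creeping g p d P ->
  0 <= 'd (fun z => 'd g z d) p d.
Proof.
move=> [[dg _] /(_ d)[d2g c2g]] Pcrit gd; rewrite leNgt; apply/negP => L0.
set D2 := fun z => 'd (fun z => 'd g z d) z d.
rewrite -/(D2 p) in L0.
set c := - D2 p / 2.
have c0 : 0 < c by rewrite divr_gt0// oppr_gt0.
have nb : nbhs p [set z | D2 z < - c].
  by apply: (cvgr_lt (D2 p)); [exact: c2g|rewrite /c; lra].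
have c40 : 0 < c / 4 by rewrite divr_gt0.
have [t [q [/andP[t0 t1] Pq gq near]]] := creeping_near gd nb c40.
(* [h] adds back the least possible loss, so it must be nonincreasing on the step. *)
pose h s := g (q + s *: d) + c / 2 * s ^+ 2.
have dh (s : R) : is_derive s 1 h ('d g (q + s *: d) d + c * s).
  have dgs := is_derive_line q d s dg.
  rewrite /h; apply: is_deriveD.
  have -> : (fun x : R => c / 2 * x ^+ 2) = (c / 2) \*: (id ^+ 2 : R -> R).
    by apply/funext => x.
  apply: is_derive_eq.
  by rewrite /= expr1 /GRing.scale/=; field.
have dhin : forall x, x \in `]0, t[ -> is_derive x 1 h ('d g (q + x *: d) d + c * x).
  by move=> x _; exact: dh.
have ch : {within `[0, t], continuous h}.
  by apply: derivable_within_continuous => x _; have [] := dh x.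
have [s + hE] := MVT t0 dhin ch.
rewrite in_itv/= => /andP[s0 st].
have [r /andP[r0 rs]] := MVT_line q d d2g s0.
rewrite (Pcrit _ Pq) subr0 -/(D2 _) => gE.
have /= := near r; rewrite (ltW r0) (ltW (lt_trans rs st)) => /(_ isT) dlt.
have : 'd g (q + s *: d) d + c * s <= 0 by rewrite gE; nra.
move=> hs.
have : h t <= h 0 by rewrite -subr_le0 hE subr0; nra.
rewrite /h scale0r addr0.
have : 0 < c * t ^+ 2 by rewrite mulr_gt0 ?exprn_gt0.
nra.
Qed.

(** * Differentials of opposite functions *)

Lemma diffNE (R : realType) (V : normedModType R) (g : V -> R) (z v : V) :
  differentiable g z -> 'd (- g) z v = - 'd g z v.
Proof. by move=> /diffN dN; exact: (congr1 (@^~ v) dN). Qed.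

Lemma C1N (R : realType) (V : normedModType R) (g : V -> R) :
  C1 g -> C1 (- g).
Proof.
move=> [dg cg]; split=> [z|v z]; first exact: differentiableN.
rewrite (_ : (fun z => _) = - (fun z => 'd g z v)); first exact/continuousN/cg.
by apply/funext => y; rewrite diffNE.
Qed.

Lemma diff2NE (R : realType) (V : normedModType R) (g : V -> R) (z v : V) :
  C2 g -> 'd (fun z => 'd (- g) z v) z v = - 'd (fun z => 'd g z v) z v.
Proof.
move=> [[dg _] g2]; rewrite -diffNE; last by have [+ _] := g2 v; exact.
congr ('d _ z v); apply/funext => y; exact: diffNE.
Qed.

Lemma C2N (R : realType) (V : normedModType R) (g : V -> R) :
  C2 g -> C2 (- g).
Proof.
move=> [g1 g2]; split=> [|v]; first exact: C1N.
rewrite (_ : (fun z => _) = - (fun z => 'd g z v)); first exact/C1N/g2.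
by apply/funext => z; rewrite diffNE//; exact: g1.1.
Qed.

(** * Gradients and Hessians of partial functions *)

(** The gradient of the restriction of [g] to an affine subspace is the
    restriction of its differential; [l] is the linear part of [a]. *)
Lemma dot_grad_affine (R : realType) (V : normedModType R) (k : nat)
    (g : V -> R) (a : 'rV[R]_k -> V) (l : {linear 'rV[R]_k -> V}) :
  (forall v u, a (v + u) = l v + a u) -> C1 g ->
  forall u v, dot v (grad (g \o a) u) = 'd g (a u) (l v).
Proof.
move=> aE [dg _] u v.
rewrite [in RHS](row_sum_delta v) !linear_sum /=; apply: eq_bigr => i _.
rewrite mxE linearZ linearZ /=; congr (_ * _).
have := @is_derive_affine R _ V R g a u (delta_mx 0 i) (l (delta_mx 0 i)).
by case=> // h; rewrite aE linearZ.
Qed.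

(** The Hessian is made of iterated partial derivatives along basis vectors;
    linearity of the outer and of the inner differential assembles them into
    the second derivative along [l v]. *)
Lemma dot_hess_affine (R : realType) (V : normedModType R) (k : nat)
    (g : V -> R) (a : 'rV[R]_k -> V) (l : {linear 'rV[R]_k -> V}) :
  (forall v u, a (v + u) = l v + a u) -> C2 g ->
  forall u v, dot v (v *m hess (g \o a) u)
    = 'd (fun z => 'd g z (l v)) (a u) (l v).
Proof.
move=> aE [[dg cg] g2] u v.
have D1 i u' : 'D_(delta_mx 0 i) (g \o a) u' = 'd g (a u') (l (delta_mx 0 i)).
  have := @is_derive_affine R _ V R g a u' (delta_mx 0 i) (l (delta_mx 0 i)).
  by case=> // h; rewrite aE linearZ.
have hessE i j : hess (g \o a) u i j
    = 'd (fun z => 'd g z (l (delta_mx 0 j))) (a u) (l (delta_mx 0 i)).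
  rewrite mxE (_ : (fun u' => 'D_(delta_mx 0 j) (g \o a) u')
    = (fun z => 'd g z (l (delta_mx 0 j))) \o a); last exact/funext/D1.
  have [d2g _] := g2 (l (delta_mx 0 j)).
  have aEi (h : R) : a (h *: delta_mx 0 i + u) = h *: l (delta_mx 0 i) + a u.
    by rewrite aE linearZ.
  by case: (is_derive_affine aEi (d2g (a u))).
have -> : (fun z => 'd g z (l v))
    = \sum_j (v 0 j \*: (fun z => 'd g z (l (delta_mx 0 j)))).
  apply/funext => z; rewrite fct_sumE [in LHS](row_sum_delta v) !linear_sum.
  by apply: eq_bigr => j _; rewrite linearZ linearZ.
have d2g j : differentiable (fun z => 'd g z (l (delta_mx 0 j))) (a u).
  by have [+ _] := g2 (l (delta_mx 0 j)); exact.
rewrite -deriveE; last first.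
  by apply: differentiable_sum => j; exact: differentiableZ.
rewrite derive_sum => [|j]; last exact/derivableZ/diff_derivable.
apply: eq_bigr => j _; rewrite deriveZ; last exact: diff_derivable.
congr (_ * _); rewrite deriveE// mxE.
rewrite [in RHS](row_sum_delta v) !linear_sum.
by apply: eq_bigr => i _; rewrite hessE !linearZ.
Qed.

Definition emb1 {R : realType} {U V : normedModType R} (u : U) : U * V := (u, 0).

Definition emb2 {R : realType} {U V : normedModType R} (v : V) : U * V := (0, v).

Lemma emb1_linear (R : realType) (U V : normedModType R) :
  linear (@emb1 R U V).
Proof.
by move=> h u u'; apply/pair_equal_spec; split; rewrite /= ?scaler0 ?addr0.
Qed.

Lemma emb2_linear (R : realType) (U V : normedModType R) :
  linear (@emb2 R U V).
Proof.
by move=> h v v'; apply/pair_equal_spec; split; rewrite /= ?scaler0 ?addr0.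
Qed.

HB.instance Definition _ (R : realType) (U V : normedModType R) :=
  GRing.isLinear.Build R U (U * V)%type _ (@emb1 R U V) (@emb1_linear R U V).

HB.instance Definition _ (R : realType) (U V : normedModType R) :=
  GRing.isLinear.Build R V (U * V)%type _ (@emb2 R U V) (@emb2_linear R U V).

Lemma emb1D (R : realType) (U V : normedModType R) (u u' : U) (y : V) :
  (u + u', y) = emb1 u + (u', y).
Proof. by apply/pair_equal_spec; split; rewrite /= ?add0r. Qed.

Lemma emb2D (R : realType) (U V : normedModType R) (x : U) (v v' : V) :
  (x, v + v') = emb2 v + (x, v').
Proof. by apply/pair_equal_spec; split; rewrite /= ?add0r. Qed.

Lemma normr_emb2 (R : realType) (U V : normedModType R) (v : V) :
  `|emb2 v : U * V| = `|v|.
Proof. by rewrite prod_normE /= normr0 max_r. Qed.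

Lemma gradxE (R : realType) (n m : nat) (f : 'rV[R]_n * 'rV[R]_m -> R)
    (xh : 'rV[R]_n) (yh : 'rV[R]_m) (v : 'rV[R]_n) :
  C1 f -> dot v (gradx f xh yh) = 'd f (xh, yh) (emb1 v).
Proof.
move=> fC; pose a (u : 'rV[R]_n) := (u, yh).
have aE u u' : a (u + u') = emb1 u + a u' by exact: emb1D.
exact: (dot_grad_affine aE fC).
Qed.

Lemma gradyE (R : realType) (n m : nat) (f : 'rV[R]_n * 'rV[R]_m -> R)
    (xh : 'rV[R]_n) (yh : 'rV[R]_m) (w : 'rV[R]_m) :
  C1 f -> dot w (grady f xh yh) = 'd f (xh, yh) (emb2 w).
Proof.
move=> fC; pose a (u : 'rV[R]_m) := (xh, u).
have aE u u' : a (u + u') = emb2 u + a u' by exact: emb2D.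
exact: (dot_grad_affine aE fC).
Qed.

Lemma hessxxE (R : realType) (n m : nat) (f : 'rV[R]_n * 'rV[R]_m -> R)
    (xh : 'rV[R]_n) (yh : 'rV[R]_m) (v : 'rV[R]_n) :
  C2 f -> dot v (v *m hessxx f xh yh)
    = 'd (fun z => 'd f z (emb1 v)) (xh, yh) (emb1 v).
Proof.
move=> fC; pose a (u : 'rV[R]_n) := (u, yh).
have aE u u' : a (u + u') = emb1 u + a u' by exact: emb1D.
exact: (dot_hess_affine aE fC).
Qed.

Lemma hessyyE (R : realType) (n m : nat) (f : 'rV[R]_n * 'rV[R]_m -> R)
    (xh : 'rV[R]_n) (yh : 'rV[R]_m) (w : 'rV[R]_m) :
  C2 f -> dot w (w *m hessyy f xh yh)
    = 'd (fun z => 'd f z (emb2 w)) (xh, yh) (emb2 w).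
Proof.
move=> fC; pose a (u : 'rV[R]_m) := (xh, u).
have aE u u' : a (u + u') = emb2 u + a u' by exact: emb2D.
exact: (dot_hess_affine aE fC).
Qed.

(** * Euclidean norm, feasible directions and closures *)

Lemma normr_le_enorm (R : realType) (k : nat) (u : 'rV[R]_k) : `|u| <= enorm u.
Proof.
rewrite /Num.norm/= mx_normrE; apply/bigmax_leP; split=> [|[i j] _ /=].
  exact: sqrtr_ge0.
rewrite ord1 -sqrtr_sqr ler_wsqrtr// /dot (bigD1 j)//= -expr2 lerDl.
by apply: sumr_ge0 => s _; rewrite -expr2 sqr_ge0.
Qed.

Lemma enormZ (R : realType) (k : nat) (t : R) (u : 'rV[R]_k) :
  enorm (t *: u) = `|t| * enorm u.
Proof.
rewrite /enorm -sqrtr_sqr -sqrtrM ?sqr_ge0//; congr Num.sqrt.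
by rewrite /dot mulr_sumr; apply: eq_bigr => i _; rewrite !mxE; ring.
Qed.

Lemma enorm0 (R : realType) (k : nat) : enorm (0 : 'rV[R]_k) = 0.
Proof. by rewrite -(scale0r (0 : 'rV[R]_k)) enormZ normr0 mul0r. Qed.

Lemma dotC (R : realType) (k : nat) (u v : 'rV[R]_k) : dot u v = dot v u.
Proof. by apply: eq_bigr => i _; rewrite mulrC. Qed.

(** Normalizing by [enorm v + 1] rather than by [enorm v] keeps [v = 0] within
    the general case and gives [t <= d] for free. *)
Lemma short_step (R : realType) (k : nat) (v x : 'rV[R]_k) (d : R) :
  0 < d -> exists t, [/\ 0 < t, t <= d & enorm (x + t *: v - x) <= d].
Proof.
move=> d0; have v0 : 0 <= enorm v by exact: sqrtr_ge0.
have K0 : 0 < enorm v + 1 by rewrite ltr_wpDl.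
exists (d / (enorm v + 1)); have t0 : 0 < d / (enorm v + 1) by rewrite divr_gt0.
split=> //; first by rewrite ler_pdivrMr// ler_peMr ?lerDr// ltW.
rewrite addrC addKr enormZ gtr0_norm// mulrAC ler_pdivrMr//.
by rewrite ler_pM2l// lerDl.
Qed.

Lemma closed_quadratic_ge0 (R : realType) (k : nat) (A : 'M[R]_k) :
  closed [set v : 'rV[R]_k | 0 <= dot v (v *m A)].
Proof.
apply: (@preimage_closed _ _ (fun v : 'rV[R]_k => dot v (v *m A)) [set x | 0 <= x]).
  suff cq : continuous (fun v : 'rV[R]_k => dot v (v *m A)) by move=> v _; exact: cq.
  apply: continuous_big => [|i _ v]; first exact: add_continuous.
  apply: continuousM; first exact: coord_continuous.
  rewrite (_ : (fun _ => _) = fun v : 'rV[R]_k => \sum_j v 0 j * A j i); last first.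
    by apply/funext => u; rewrite mxE.
  move: v; apply: continuous_big => [|j _ v]; first exact: add_continuous.
  by apply: continuousM; [exact: coord_continuous|exact: cst_continuous].
exact: closed_ge.
Qed.

Lemma feasible_segment (R : realType) (k : nat) (O : set 'rV[R]_k) x w :
  convex_set O -> O x -> feasible_dirs O x w ->
  exists2 l : R, 0 < l & forall t, 0 <= t <= l -> O (x + t *: w).
Proof.
move=> Oc Ox [l l0 Oxl]; exists l => // t /andP[t0 tl].
have s0 : 0 <= t / l by rewrite divr_ge0// ltW.
have s1 : t / l <= 1 by rewrite ler_pdivrMr// mul1r.
have := Oc (x + l *: w) x (Itv01 s0 s1); rewrite !inE => /(_ Oxl Ox).
congr O; rewrite /conv/= scalerDr scalerA divfK ?gt_eqF//.
by rewrite addrAC -scalerDl unstable.add_onemK scale1r.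
Qed.

Lemma closure_subset (T : topologicalType) (A B : set T) :
  closed B -> A `<=` B -> closure A `<=` B.
Proof. by move=> /closure_id {2}-> AB; exact: closureS. Qed.

(** * Local minimax points *)

(** The base point is [(xh, y)], where [y] is an answer to [xh + t *: v] whose
    value falls short of [f (xh, yh)] by less than [c * t ^ 2].  The radius [r]
    serves at second order, to confine [y] to a ball on which the direction is
    critical. *)
Lemma local_minimax_creeping_x (R : realType) (n m : nat)
    (X : set 'rV[R]_n) (Y : set 'rV[R]_m) (f : 'rV[R]_n * 'rV[R]_m -> R)
    (xh : 'rV[R]_n) (yh : 'rV[R]_m) (v : 'rV[R]_n) (r : R) :
  local_minimax X Y f xh yh -> convex_set X -> feasible_dirs X xh v -> 0 < r ->
  creeping f (xh, yh) (emb1 v) [set (xh, y) | y in eball yh r].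
Proof.
move=> [Xx Yy [d0 [tau [d00 _ tau0 mm]]]] Xc vX r0 e c e0 c0.
have [l l0 Xl] := feasible_segment Xc Xx vX.
have s0 : 0 < Num.min d0 (Num.min r e) by rewrite !lt_min d00 r0.
have [d [dpos dd0 de dle dl]] : exists d, [/\ 0 < d, d <= d0, d < e, d <= l
    & tau d < Num.min d0 (Num.min r e)].
  near (0 : R)^'+ => d; exists d; split; near: d.
  - exact: nbhs_right_gt.
  - exact: nbhs_right_le.
  - exact: nbhs_right_lt.
  - exact: nbhs_right_le.
  - exact: cvgr_lt tau0 _ s0.
have [t [t0 tld xt]] := short_step v xh dpos.
have Xt : X (xh + t *: v) by apply: Xl; rewrite ltW//= (le_trans tld).
have [||_ supf] := mm d _ _ _ Xt Yy xt; rewrite ?dpos// ?subrr ?enorm0 ?ltW//.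
have slack : ((f (xh, yh) - c * t ^+ 2)%:E < (f (xh, yh))%:E)%E.
  by rewrite lte_fin ltrBlDr ltrDl mulr_gt0// exprn_gt0.
have /ereal_sup_gt[_ [y [Yyy yt] <-]] := lt_le_trans slack supf.
rewrite lte_fin => /ltW fy.
have := le_lt_trans yt dl; rewrite !lt_min => /and3P[yd0 yr ye].
exists t, (xh, y); split.
- by rewrite t0 (le_lt_trans tld).
- have -> : (xh, y) - (xh, yh) = emb2 (y - yh).
    by rewrite -[y in LHS](subrK yh) emb2D addrK.
  by rewrite normr_emb2 (le_lt_trans (normr_le_enorm _)).
- by exists y => //; exact: ltW.
- have -> : (xh, y) + t *: emb1 v = (xh + t *: v, y).
    by rewrite [xh + _]addrC emb1D linearZ addrC.
  (* [f (xh, y) <= f (xh, yh)], because [y] is within [d0] of [yh]. *)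
  apply: le_trans fy; rewrite lerD2r.
  by have [|||] := mm d0 _ _ _ Xx Yyy; rewrite ?d00 ?lexx// ?subrr ?enorm0 ?ltW.
Unshelve. all: by end_near. Qed.

Lemma local_minimax_creeping_y (R : realType) (n m : nat)
    (X : set 'rV[R]_n) (Y : set 'rV[R]_m) (f : 'rV[R]_n * 'rV[R]_m -> R)
    (xh : 'rV[R]_n) (yh : 'rV[R]_m) (w : 'rV[R]_m) :
  local_minimax X Y f xh yh -> convex_set Y -> feasible_dirs Y yh w ->
  creeping (- f) (xh, yh) (emb2 w) [set (xh, yh)].
Proof.
move=> [Xx Yy [d0 [tau [d00 _ _ mm]]]] Yc wY e c e0 c0.
have [l l0 Yl] := feasible_segment Yc Yy wY.
have [d [dpos dd0 de dl]] : exists d, [/\ 0 < d, d <= d0, d < e & d <= l].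
  near (0 : R)^'+ => d; exists d; split; near: d.
  - exact: nbhs_right_gt.
  - exact: nbhs_right_le.
  - exact: nbhs_right_lt.
  - exact: nbhs_right_le.
have [t [t0 tld yt]] := short_step w yh dpos.
exists t, (xh, yh); split=> //.
- by rewrite t0 (le_lt_trans tld).
- by rewrite subrr normr0.
have Yt : Y (yh + t *: w) by apply: Yl; rewrite ltW//= (le_trans tld).
have fle : f (xh, yh + t *: w) <= f (xh, yh).
  have [||] := mm d0 _ _ _ Xx Yt _ (le_trans yt dd0);
    by rewrite ?d00 ?lexx// ?subrr ?enorm0 ?ltW.
have -> : (xh, yh) + t *: emb2 w = (xh, yh + t *: w).
  by rewrite [yh + _]addrC emb2D linearZ addrC.
rewrite !opprfctE.
by rewrite lerBlDr -[leLHS]addr0 lerD ?lerN2// mulr_ge0 ?sqr_ge0// ltW.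
Unshelve. all: by end_near. Qed.

Theorem theorem3p2 (R : realType) (n m : nat)
  (X : set 'rV[R]_n) (Y : set 'rV[R]_m) (f : 'rV[R]_n * 'rV[R]_m -> R)
  (xh : 'rV[R]_n) (yh : 'rV[R]_m)
  (X0 : X !=set0) (Xclosed : closed X) (Xconvex : convex_set X)
  (Y0 : Y !=set0) (Yclosed : closed Y) (Yconvex : convex_set Y)
  (fC1 : C1 f)
  (fmax : forall x, X x -> max_over f x Y \is a fin_num)
  (hmm : local_minimax X Y f xh yh) :
  (0 \in [set gradx f xh yh + z | z in normal_cone X xh] /\
   0 \in [set - grady f xh yh + z | z in normal_cone Y yh]) /\
  (C2 f ->
   (forall v,
      closure [set vb | exists2 delta : R, 0 < delta &
                 forall y', eball yh delta y' -> Gamma1 X f xh y' vb] v ->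
      0 <= dot v (v *m hessxx f xh yh)) /\
   (forall w, closure (Gamma2 Y f xh yh) w ->
      dot w (w *m hessyy f xh yh) <= 0)).
Proof.
have feasible k (O : set 'rV[R]_k) x y : O y -> feasible_dirs O x (y - x).
  by move=> Oy; exists 1 => //; rewrite scale1r addrC subrK.
have dotNl k (u v : 'rV[R]_k) : dot (- u) v = - dot v u.
  by rewrite /dot -sumrN; apply: eq_bigr => i _; rewrite mxE mulNr mulrC.
split; first split.
- apply/mem_set; exists (- gradx f xh yh); last by rewrite subrr.
  move=> x Xx; rewrite dotNl (gradxE _ _ _ fC1) oppr_le0.
  apply: (creeping_diff_ge0 fC1).
  exact: (local_minimax_creeping_x hmm Xconvex (feasible _ _ _ _ Xx) ltr01).
- apply/mem_set; exists (grady f xh yh); last by rewrite addNr.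
  move=> y Yy; rewrite dotC (gradyE _ _ _ fC1) -oppr_ge0 -diffNE; last exact: fC1.1.
  apply: (creeping_diff_ge0 (C1N fC1)).
  exact: (local_minimax_creeping_y hmm Yconvex (feasible _ _ _ _ Yy)).
move=> fC2; split=> [v|w].
- apply: (closure_subset (@closed_quadratic_ge0 R n _)) => {}v [d d0 vG].
  have [vX _] : Gamma1 X f xh yh v.
    by apply: vG; rewrite /eball/= subrr enorm0 ltW.
  rewrite /= (hessxxE _ _ _ fC2).
  apply: (creeping_diff2_ge0 fC2 _ (local_minimax_creeping_x hmm Xconvex vX d0)).
  by move=> _ [y /vG[_ vy] <-]; rewrite -(gradxE _ _ _ fC1).
- rewrite -oppr_ge0.
  have quadN u : - dot u (u *m hessyy f xh yh) = dot u (u *m - hessyy f xh yh).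
    by rewrite mulmxN /dot -sumrN; apply: eq_bigr => i _; rewrite [in RHS]mxE mulrN.
  rewrite quadN.
  apply: (closure_subset (@closed_quadratic_ge0 R m _)) => {}w [wY wcrit].
  rewrite /= -quadN (hessyyE _ _ _ fC2).
  rewrite -(diff2NE _ _ fC2).
  apply: (creeping_diff2_ge0 (C2N fC2) _ (local_minimax_creeping_y hmm Yconvex wY)).
  move=> _ ->; rewrite diffNE; last exact: fC1.1.
  by rewrite -(gradyE _ _ _ fC1) wcrit oppr0.
Qed.
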